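(* Let $n,m,T\in\mathbb{N}$, $U\subset\mathbb{R}^m$, $X_t\subset\mathbb{R}^n$ for $t\in\{0,\dots,T\}$, $f:\mathbb{R}^n\times\mathbb{R}^m\times\mathbb{N}\to\mathbb{R}^n$, $x_0\in X_0$. Suppose $J:U^T\times\prod_{t=0}^T X_t\to\mathbb{R}$ is additively separable, with associated cost functions $c_t:X_t\times U\to\mathbb{R}$ ($0\le t\le T-1$) and $c_T:X_T\to\mathbb{R}$ that are bounded. Let $F:\mathbb{R}^n\times[0,T]\to\mathbb{R}$ satisfy $$F(x,T)=c_T(x)\ \text{ for all }x\in X_T,$$ $$F(x,t)=\inf_{u\in\Gamma_{x,t}}\{c_t(x,u)+F(f(x,u,t),t+1)\}\ \text{ for all }t\in\{0,\dots,T-1\},\ x\in X_t.$$ Then $F$ is a value function for the MSOP associated with $\{J,f,\{X_t\}_{0\le t\le T},U,T\}$. Moreover, if $\Gamma_{x,t}\neq\emptyset$ for all $t\in\{0,\dots,T-1\}$ and $x\in X_t$, then $\mathbf{x}^*=(x^*(0),\dots,x^*(T))$ and $\mathbf{u}^*=(u^*(0),\dots,u^*(T-1))$ solve the MSOP with initial condition $x_0$ if and only if, for all $k\in\{0,\dots,T-1\}$, $$u^*(k)\in\arg\inf_{u\in\Gamma_{x^*(k),k}}\{c_k(x^*(k),u)+F(f(x^*(k),u,k),k+1)\},$$ $$x^*(0)=x_0,\qquad x^*(k+1)=f(x^*(k),u^*(k),k).$$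
   Context: **MSOP.** The Multi-Stage Optimization Problem (MSOP) associated with $\{J,f,\{X_t\}_{0\le t\le T},U,T\}$ and initial condition $x_0$ is: minimize $J(\mathbf{u},\mathbf{x})$ over $\mathbf{u}=(u(0),\dots,u(T-1))$, $\mathbf{x}=(x(0),\dots,x(T))$ subject to $x(0)=x_0$, $x(t+1)=f(x(t),u(t),t)$ and $u(t)\in U$ for $t=0,\dots,T-1$, and $x(t)\in X_t$ for $t=0,\dots,T$. A pair $(\mathbf{u}^*,\mathbf{x}^* )$ solves the MSOP if it is feasible and attains the minimum. **Feasible inputs.** For $t\in\{0,\dots,T-1\}$, $x\in X_t$: $\Gamma_{x,t}:=\{u\in U:f(x,u,t)\in X_{t+1}\}$. $(u(s),\dots,u(T-1))\in\Gamma_{x,[s,T-1]}$ means $u(t)\in\Gamma_{x(t),t}$ for all $t\in\{s,\dots,T-1\}$, where $x(s)=x$ and $x(k+1)=f(x(k),u(k),k)$. Membership in $\arg\inf_{u\in\Gamma}$ means belonging to $\Gamma$ and attaining the infimum. **Additively separable.** $J:U^T\times\prod_{t=0}^T X_t\to\mathbb{R}$ is additively separable with cost functions $\{c_t\}_{t=0}^T$ if $J(\mathbf{u},\mathbf{x})=\sum_{t=0}^{T-1}c_t(x(t),u(t))+c_T(x(T))$. **Value function.** If $J(\mathbf u,\mathbf x)=\phi_0(x(0),u(0),\phi_1(x(1),u(1),\dots\phi_T(x(T))\dots))$ with maps $\phi_t$ monotone non-decreasing in their third argument, $V:\mathbb{R}^n\times[0,T]\to\mathbb{R}$ is a value function of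 the MSOP if $V(x,T)=\phi_T(x)$ for $x\in X_T$ and, for $t\in\{0,\dots,T-1\}$, $x\in X_t$, $V(x,t)=\inf_{(u(t),\dots,u(T-1))\in\Gamma_{x,[t,T-1]}}\phi_t(x(t),u(t),\phi_{t+1}(x(t+1),u(t+1),\dots\phi_T(x(T))\dots))$ with $x(t)=x$, $x(k+1)=f(x(k),u(k),k)$. For additively separable $J$ the maps are $\phi_T(x)=c_T(x)$ and $\phi_t(x,u,z)=c_t(x,u)+z$, so the condition reads $V(x,T)=c_T(x)$ and $V(x,t)=\inf_{(u(t),\dots,u(T-1))\in\Gamma_{x,[t,T-1]}}\{\sum_{s=t}^{T-1}c_s(x(s),u(s))+c_T(x(T))\}$. *)

(* Defs.v *)
From HB Require Import structures.
From mathcomp Require Import all_boot all_order all_algebra.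
From mathcomp Require Import all_classical all_reals all_analysis.
Import Order.TTheory GRing.Theory Num.Theory.
Import numFieldNormedType.Exports.

Set Implicit Arguments.
Unset Strict Implicit.
Unset Printing Implicit Defensive.

Local Open Scope classical_set_scope.
Local Open Scope ring_scope.

(* Stages t in {0,...,T-1} are 'I_T, times t in {0,...,T} are 'I_T.+1.  A stage
   t, seen as a time, is [stage_time t]; the time t + 1 is [next_time t]. *)
Definition stage_time T (t : 'I_T) : 'I_T.+1 := widen_ord (leqnSn T) t.
Definition next_time T (t : 'I_T) : 'I_T.+1 := lift ord0 t.

(* Infima are taken in the extended reals, so that the infimum over the empty
   set is +oo and that of a set unbounded below is -oo. *)
Definition inf_over (R : realType) (V : Type) (A : set V) (g : V -> R) : \bar R :=
  ereal_inf [set (g a)%:E | a in A].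

Definition arginf (R : realType) (V : Type) (A : set V) (g : V -> R) : set V :=
  [set a | A a /\ (g a)%:E = inf_over A g].

Section MSOP.
Variables (R : realType) (n m T : nat).

(* Input and state sequences (u(0),...,u(T-1)) and (x(0),...,x(T)). *)
Notation inputs := ('I_T -> 'cV[R]_m).
Notation states := ('I_T.+1 -> 'cV[R]_n).

(* An objective is total, but only its values on U^T x prod_t X_t are ever
   constrained or used; the same holds for the stage costs on X_t x U. *)
Variable J : inputs -> states -> R.
Variable f : 'cV[R]_n -> 'cV[R]_m -> nat -> 'cV[R]_n.
Variable X : 'I_T.+1 -> set 'cV[R]_n.
Variable U : set 'cV[R]_m.

Definition msop_feasible (x0 : 'cV[R]_n) (u : inputs) (x : states) : Prop :=
  [/\ x ord0 = x0,
      forall t : 'I_T, x (next_time t) = f (x (stage_time t)) (u t) t,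
      forall t : 'I_T, U (u t)
    & forall t : 'I_T.+1, X t (x t)].

Definition msop_solves (x0 : 'cV[R]_n) (u : inputs) (x : states) : Prop :=
  msop_feasible x0 u x /\
  forall u' x', msop_feasible x0 u' x' -> J u x <= J u' x'.

Definition feasible_inputs (x : 'cV[R]_n) (t : 'I_T) : set 'cV[R]_m :=
  [set u | U u /\ X (next_time t) (f x u t)].

(* The pairs of a tail (u(s),...,u(T-1)) in Gamma_{x0,[s,T-1]} and the tail
   (x(s),...,x(T)) of states it generates from x(s) = x0.  Both are carried by
   sequences over the whole horizon whose entries before time s are arbitrary
   and play no role. *)
Definition feasible_tails (x0 : 'cV[R]_n) (s : 'I_T) : set (inputs * states) :=
  [set ux | [/\ ux.2 (stage_time s) = x0,
    forall k : 'I_T, (s <= k)%N -> ux.2 (next_time k) = f (ux.2 (stage_time k)) (ux.1 k) k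
  & forall k : 'I_T, (s <= k)%N -> feasible_inputs (ux.2 (stage_time k)) k (ux.1 k)]].

Variable c : 'I_T -> 'cV[R]_n -> 'cV[R]_m -> R.
Variable cT : 'cV[R]_n -> R.

Definition additively_separable : Prop :=
  forall (u : inputs) (x : states),
    (forall t, U (u t)) -> (forall t, X t (x t)) ->
    J u x = \sum_(t < T) c t (x (stage_time t)) (u t) + cT (x ord_max).

(* For an additively separable objective the nested representation
   phi_0(x(0), u(0), phi_1(... phi_T(x(T)) ...)) has phi_T = cT and
   phi_t(x, u, z) = c_t(x, u) + z, so the cost-to-go from time s is a sum. *)
Definition value_function (V : 'cV[R]_n -> 'I_T.+1 -> R) : Prop :=
  (forall x, X ord_max x -> V x ord_max = cT x) /\
  (forall (s : 'I_T) x, X (stage_time s) x ->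
    (V x (stage_time s))%:E =
      inf_over (feasible_tails x s) (fun ux =>
        \sum_(t < T | (s <= t)%N) c t (ux.2 (stage_time t)) (ux.1 t)
        + cT (ux.2 ord_max))).

End MSOP.

(* Main.v *)
Require Import Defs.
From HB Require Import structures.
From mathcomp Require Import all_boot all_order all_algebra.
From mathcomp Require Import all_classical all_reals all_analysis.
Import Order.TTheory GRing.Theory Num.Theory.
Import numFieldNormedType.Exports.
Local Open Scope classical_set_scope.
Local Open Scope ring_scope.

Set Implicit Arguments.
Unset Strict Implicit.
Unset Printing Implicit Defensive.

(** The amount by which a feasible input exceeds the Bellman infimum is its
    nonnegative "slack".  Along a trajectory the values of [F] telescope, so the
    cost-to-go of a tail minus the value of [F] at its start is the sum of the slacks.
    Inputs of arbitrarily small slack always exist because [F] is real-valued, so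
    [F] is the infimum of the cost-to-go; and a trajectory is optimal exactly
    when its slacks sum to 0, that is, when every one of them vanishes. *)

Section InfOver.
Variables (R : realType) (V : Type) (A : set V) (g : V -> R) (r : R).

Lemma inf_over_le a : r%:E = inf_over A g -> A a -> r <= g a.
Proof.
move=> rE Aa; rewrite -lee_fin rE.
by apply: ereal_inf_lbound; exists a.
Qed.

(** The equation with the real number [r] makes the infimum finite. This also makes [A] nonempty,
    since the infimum over the empty set is +oo. *)
Lemma inf_over_adherent (e : R) : r%:E = inf_over A g -> 0 < e ->
  exists2 a, A a & g a <= r + e.
Proof.
move=> rE e0.
have fin : ereal_inf [set (g a)%:E | a in A] \is a fin_num.
  by rewrite -[ereal_inf _]/(inf_over A g) -rE.
have [_ [a Aa <-]] := lb_ereal_inf_adherent e0 fin.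
rewrite -[ereal_inf _]/(inf_over A g) -rE -EFinD lte_fin => /ltW.
by exists a.
Qed.

Lemma inf_over_eq : (forall a, A a -> r <= g a) ->
  (forall e, 0 < e -> exists2 a, A a & g a <= r + e) -> r%:E = inf_over A g.
Proof.
move=> lb adh; apply/le_anti/andP; split.
  by apply: le_ereal_inf_tmp => _ [a Aa <-]; rewrite lee_fin lb.
apply/lee_addgt0Pr => e e0; have [a Aa ga] := adh e e0.
apply: (@le_trans _ _ (g a)%:E); last by rewrite -EFinD lee_fin.
by apply: ereal_inf_lbound; exists a.
Qed.

End InfOver.

(** Induction in the form in which trajectories evolve: each step is indexed by a stage and leads
    from [stage_time k] to [next_time k]. *)
Lemma time_ind (T : nat) (s : 'I_T.+1) (P : 'I_T.+1 -> Prop) :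
  P s ->
  (forall k : 'I_T, (s <= k)%N -> P (stage_time k) -> P (next_time k)) ->
  forall t : 'I_T.+1, (s <= t)%N -> P t.
Proof.
move=> Ps PS [i]; elim: i => [|i IHi] iT /= si.
  suff -> : Ordinal iT = s by [].
  by apply/val_inj/esym/eqP; rewrite -leqn0.
have [si1|nsi1] := eqVneq (val s) i.+1.
  by suff -> : Ordinal iT = s by []; apply/val_inj.
have si' : (s <= i)%N by rewrite -ltnS ltn_neqAle nsi1.
have iT' : (i < T)%N by [].
have -> : Ordinal iT = next_time (Ordinal iT') by apply/val_inj.
apply: PS => //.
have -> : stage_time (Ordinal iT') = Ordinal (ltnW iT) by apply/val_inj.
exact: IHi.
Qed.

(** Serves to run closed-loop dynamics forward from time [s]. *)
Lemma time_rec (T : nat) (A : Type) (s : 'I_T.+1) (a : A) (g : 'I_T -> A -> A) :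
  exists x : 'I_T.+1 -> A, x s = a /\
    forall k : 'I_T, (s <= k)%N -> x (next_time k) = g k (x (stage_time k)).
Proof.
(* The recursion is structural on naturals; [a] is the default at every index up to [s] and beyond
   [T]. *)
pose z := fix z (i : nat) : A :=
  if i is j.+1 then
    if insub j is Some k then if (s <= j)%N then g k (z j) else a else a
  else a.
exists (fun t => z t); split.
  suff za i : (i <= s)%N -> z i = a by apply: za.
  by case: i => //= j js; case: insub => // k; rewrite leqNgt js.
by move=> k sk; rewrite [z (next_time k)]/= valK sk.
Qed.

Lemma telescope_time (V : zmodType) (T : nat) (s : 'I_T.+1) (a : 'I_T.+1 -> V) :
  \sum_(t < T | (s <= t)%N) (a (next_time t) - a (stage_time t)) =
  a ord_max - a s.
Proof.
have sT : (s <= T)%N by rewrite -ltnS.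
(* Through [inord] the sum becomes one over a range of naturals, where telescoping applies. *)
transitivity (\sum_(s <= t < T) (a (inord t.+1) - a (inord t))).
  rewrite (big_nat_widenl _ 0) // big_mkord; apply: eq_big => // t _.
  by congr (a _ - a _); apply/val_inj; rewrite /= inordK ?lift0 // ltnS // ltnW.
rewrite telescope_sumr // inord_val; congr (a _ - _).
by apply/val_inj; rewrite /= inordK.
Qed.

Section Bellman.
Variables (R : realType) (n m T : nat) (U : set 'cV[R]_m).
Variables (X : 'I_T.+1 -> set 'cV[R]_n) (f : 'cV[R]_n -> 'cV[R]_m -> nat -> 'cV[R]_n).
Variables (c : 'I_T -> 'cV[R]_n -> 'cV[R]_m -> R) (cT : 'cV[R]_n -> R).
Variable F : 'cV[R]_n -> 'I_T.+1 -> R.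
Hypothesis hFT : forall x, X ord_max x -> F x ord_max = cT x.
Hypothesis hF : forall (t : 'I_T) x, X (stage_time t) x ->
  (F x (stage_time t))%:E =
    inf_over (feasible_inputs f X U x t) (fun u => c t x u + F (f x u t) (next_time t)).

(* Unlike [feasible_tails], this allows [s] to be the final time, which is
   the only time there is when [T = 0]. *)
Definition admissible (s : 'I_T.+1) (u : 'I_T -> 'cV[R]_m) (x : 'I_T.+1 -> 'cV[R]_n) :=
  forall k : 'I_T, (s <= k)%N ->
    x (next_time k) = f (x (stage_time k)) (u k) k /\
    feasible_inputs f X U (x (stage_time k)) k (u k).

Definition cost_to_go (s : 'I_T.+1) (u : 'I_T -> 'cV[R]_m) (x : 'I_T.+1 -> 'cV[R]_n) : R :=
  \sum_(t < T | (s <= t)%N) c t (x (stage_time t)) (u t) + cT (x ord_max).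

(** The successor is written through [f] rather than as [x (next_time t)], so that the slack
    compares the Bellman objective with its infimum whether or not [x] follows the dynamics. *)
Definition slack (u : 'I_T -> 'cV[R]_m) (x : 'I_T.+1 -> 'cV[R]_n) (t : 'I_T) : R :=
  c t (x (stage_time t)) (u t) + F (f (x (stage_time t)) (u t) t) (next_time t)
  - F (x (stage_time t)) (stage_time t).

Lemma admissible_states s u x : X s (x s) -> admissible s u x ->
  forall t : 'I_T.+1, (s <= t)%N -> X t (x t).
Proof.
move=> Xs adm; apply: time_ind => // k sk _.
by have [-> []] := adm k sk.
Qed.

Lemma slack_ge0 s u x (t : 'I_T) : X s (x s) -> admissible s u x -> (s <= t)%N ->
  0 <= slack u x t.
Proof.
move=> Xs adm st; rewrite subr_ge0.
have Xt : X (stage_time t) (x (stage_time t)) by apply: admissible_states adm _ _.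
by have [_ Gt] := adm t st; apply: inf_over_le (hF Xt) Gt.
Qed.

Lemma cost_to_goE s u x : X s (x s) -> admissible s u x ->
  cost_to_go s u x = F (x s) s + \sum_(t < T | (s <= t)%N) slack u x t.
Proof.
move=> Xs adm; have Xmax : X ord_max (x ord_max).
  by apply: admissible_states adm _ _ => //; rewrite -ltnS.
rewrite /cost_to_go -hFT //.
(* The dynamics turn [f] of the current state into the next state, so that the [F] terms become
   increments along the trajectory. *)
have -> : \sum_(t < T | (s <= t)%N) slack u x t =
    \sum_(t < T | (s <= t)%N) c t (x (stage_time t)) (u t) +
    \sum_(t < T | (s <= t)%N)
      (F (x (next_time t)) (next_time t) - F (x (stage_time t)) (stage_time t)).
  rewrite -big_split /=; apply: eq_bigr => t st.
  by rewrite /slack -(proj1 (adm t st)) addrA.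
rewrite (telescope_time s (fun t => F (x t) t)) /=.
by rewrite addrCA [F (x s) s + _]addrC subrK.
Qed.

Lemma value_le_cost_to_go s u x : X s (x s) -> admissible s u x ->
  F (x s) s <= cost_to_go s u x.
Proof.
move=> Xs adm; rewrite cost_to_goE // lerDl sumr_ge0 // => t st.
exact: slack_ge0 adm st.
Qed.

(** Choice yields a feedback law [mu] of slack at most [d] at every stage and state; its closed loop
    started at [x0] is the required tail. *)
Lemma near_optimal_tail s x0 (e : R) : X s x0 -> 0 < e -> exists u x,
  [/\ x s = x0, admissible s u x & cost_to_go s u x <= F x0 s + e].
Proof.
(* At most [T] slacks of size [d] add up to at most [e]; dividing by [T.+1] also covers [T = 0]. *)
move=> Xx0 e0; pose d := e / T.+1%:R.
have d0 : 0 < d by rewrite divr_gt0.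
pose near_optimal (tx : 'I_T * 'cV[R]_n) (u : 'cV[R]_m) :=
  X (stage_time tx.1) tx.2 -> feasible_inputs f X U tx.2 tx.1 u /\
    c tx.1 tx.2 u + F (f tx.2 u tx.1) (next_time tx.1) <= F tx.2 (stage_time tx.1) + d.
have [mu muP] : {mu & forall tx, near_optimal tx (mu tx)}.
  apply: choice => -[t x].
  (* Outside the state constraint [near_optimal] holds vacuously, and 0 is a default input. *)
  have [Xt|nXt] := pselect (X (stage_time t) x); last by exists 0.
  by have [u Gu ule] := inf_over_adherent (hF Xt) d0; exists u.
have [x [xs xS]] := time_rec s x0 (fun k y => f y (mu (k, y)) k).
(* The guarantee on [mu] is available only at states in [X], so this invariant comes first. *)
have Xx : forall t : 'I_T.+1, (s <= t)%N -> X t (x t).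
  apply: time_ind; first by rewrite xs.
  move=> k sk Xk; rewrite xS //.
  by have [[]] := muP (k, x (stage_time k)) Xk.
pose u k := mu (k, x (stage_time k)).
have adm : admissible s u x.
  move=> k sk; split; first exact: xS.
  by have [] := muP (k, x (stage_time k)) (Xx (stage_time k) sk).
exists u, x; split=> //; rewrite cost_to_goE ?xs // lerD2l.
apply: (@le_trans _ _ (\sum_(t < T | (s <= t)%N) d)).
  apply: ler_sum => t st; rewrite lerBlDl.
  by have [] := muP (t, x (stage_time t)) (Xx (stage_time t) st).
rewrite sumr_const -mulr_natr -mulrA -[leRHS]mulr1 ler_pM2l // ler_pdivrMl // mulr1.
by rewrite ler_nat (leq_trans (max_card _)) // card_ord.
Qed.

Lemma bellman_value_function : value_function f X U c cT F.
Proof.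
split=> // s x Xx; apply: inf_over_eq => [[u y] /= [yx dyn feas]|e e0].
  rewrite -yx; apply: value_le_cost_to_go; first by rewrite yx.
  by move=> k sk; split; [apply: dyn|apply: feas].
have [u [y [yx adm cost]]] := near_optimal_tail Xx e0.
by exists (u, y) => //; split=> //= k /(adm k) [].
Qed.

(** Feasible inputs keep each successor state in its constraint set, so the state constraints
    propagate from [x0]. *)
Lemma msop_feasible_admissible x0 u x : X ord0 x0 ->
  msop_feasible f X U x0 u x <-> x ord0 = x0 /\ admissible ord0 u x.
Proof.
move=> Xx0; split=> [[xx0 dyn Uu Xx]|[xx0 adm]].
  split=> // k _; split; first exact: dyn.
  by split=> //; rewrite -dyn.
split=> // [t|t|t]; [by have [] := adm t (leq0n t)|by have [_ []] := adm t (leq0n t)|].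
by apply: (admissible_states (s := ord0)) adm _ _; rewrite ?xx0.
Qed.

Variable J : ('I_T -> 'cV[R]_m) -> ('I_T.+1 -> 'cV[R]_n) -> R.
Hypothesis hJ : additively_separable J X U c cT.

Lemma objective_cost_to_go x0 u x : msop_feasible f X U x0 u x ->
  J u x = cost_to_go ord0 u x.
Proof. by case=> _ _ Uu Xx; rewrite hJ. Qed.

(** [F x0 ord0] bounds every feasible cost from below and is approached within any [e] by feasible
    pairs, so only it can be the minimum. *)
Lemma msop_solves_value x0 u x : X ord0 x0 ->
  msop_solves J f X U x0 u x <->
  msop_feasible f X U x0 u x /\ cost_to_go ord0 u x = F x0 ord0.
Proof.
move=> Xx0; split=> [[feas opt]|[feas cost]]; split=> //.
  have [xx0 adm] := (msop_feasible_admissible u x Xx0).1 feas.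
  apply/le_anti/andP; split; last by rewrite -xx0 value_le_cost_to_go ?xx0.
  apply/ler_addgt0Pr => e e0.
  have [v [y [yx0 admy costy]]] := near_optimal_tail Xx0 e0.
  have feasy : msop_feasible f X U x0 v y by apply/msop_feasible_admissible.
  by rewrite -(objective_cost_to_go feas) (le_trans (opt _ _ feasy)) ?(objective_cost_to_go feasy).
move=> v y feasy; rewrite (objective_cost_to_go feas) (objective_cost_to_go feasy) cost.
have [yx0 admy] := (msop_feasible_admissible v y Xx0).1 feasy.
by rewrite -yx0 value_le_cost_to_go ?yx0.
Qed.

Lemma msop_solves_slack x0 u x : X ord0 x0 ->
  msop_solves J f X U x0 u x <->
  [/\ x ord0 = x0, admissible ord0 u x & forall t, slack u x t = 0].
Proof.
move=> Xx0; rewrite msop_solves_value // msop_feasible_admissible //.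
split=> [[[xx0 adm]]|[xx0 adm slack0]].
  rewrite cost_to_goE ?xx0 // => /eqP; rewrite addrC -subr_eq0 addrK.
  rewrite psumr_eq0 => [/allP sl|t _]; last by apply: slack_ge0 adm _; rewrite ?xx0.
  by split=> // t; apply/eqP/(implyP (sl t _)); rewrite ?mem_index_enum.
by split=> //; rewrite cost_to_goE ?xx0 // big1 ?addr0.
Qed.

(** By the Bellman equation the infimum is the value of [F] at the current state, so attaining it
    leaves no excess. *)
Lemma arginf_slack u x (t : 'I_T) : X (stage_time t) (x (stage_time t)) ->
  arginf (feasible_inputs f X U (x (stage_time t)) t)
    (fun v => c t (x (stage_time t)) v + F (f (x (stage_time t)) v t) (next_time t)) (u t) <->
  feasible_inputs f X U (x (stage_time t)) t (u t) /\ slack u x t = 0.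
Proof.
move=> Xt; rewrite /arginf /= -hF //; split=> -[Gt]; rewrite /slack.
  by move=> [->]; rewrite subrr.
by move=> /eqP; rewrite subr_eq0 => /eqP ->.
Qed.

Lemma msop_solves_arginf x0 u x : X ord0 x0 ->
  msop_solves J f X U x0 u x <->
  [/\ forall k : 'I_T,
        arginf (feasible_inputs f X U (x (stage_time k)) k)
          (fun v => c k (x (stage_time k)) v + F (f (x (stage_time k)) v k) (next_time k))
          (u k),
      x ord0 = x0
    & forall k : 'I_T, x (next_time k) = f (x (stage_time k)) (u k) k].
Proof.
move=> Xx0; rewrite msop_solves_slack //; split=> [[xx0 adm slack0]|[opt xx0 dyn]].
  split=> // k; last by have [] := adm k (leq0n k).
  apply/arginf_slack; last by have [] := adm k (leq0n k).
  by apply: (admissible_states (s := ord0)) adm _ _; rewrite ?xx0.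
(* Membership in [arginf] includes feasibility of the input, so admissibility comes before any state
   constraint is known. *)
have adm : admissible ord0 u x by move=> k _; split=> //; have [] := opt k.
split=> // t; have Xt : X (stage_time t) (x (stage_time t)).
  by apply: (admissible_states (s := ord0)) adm _ _; rewrite ?xx0.
by have [] := (arginf_slack u Xt).1 (opt t).
Qed.

End Bellman.

Theorem corollary11 (R : realType) (n m T : nat)
  (U : set 'cV[R]_m) (X : 'I_T.+1 -> set 'cV[R]_n)
  (f : 'cV[R]_n -> 'cV[R]_m -> nat -> 'cV[R]_n)
  (x0 : 'cV[R]_n) (hx0 : X ord0 x0)
  (J : ('I_T -> 'cV[R]_m) -> ('I_T.+1 -> 'cV[R]_n) -> R)
  (c : 'I_T -> 'cV[R]_n -> 'cV[R]_m -> R) (cT : 'cV[R]_n -> R)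
  (hJ : additively_separable J X U c cT)
  (hc : forall t : 'I_T, [bounded c t xu.1 xu.2 | xu in X (stage_time t) `*` U])
  (hcT : [bounded cT x | x in X ord_max])
  (F : 'cV[R]_n -> 'I_T.+1 -> R)
  (hFT : forall x, X ord_max x -> F x ord_max = cT x)
  (hF : forall (t : 'I_T) x, X (stage_time t) x ->
    (F x (stage_time t))%:E =
      inf_over (feasible_inputs f X U x t) (fun u => c t x u + F (f x u t) (next_time t))) :
  value_function f X U c cT F /\
  ((forall (t : 'I_T) x, X (stage_time t) x -> feasible_inputs f X U x t !=set0) ->
   forall (us : 'I_T -> 'cV[R]_m) (xs : 'I_T.+1 -> 'cV[R]_n),
     msop_solves J f X U x0 us xs <->
     [/\ forall k : 'I_T,
           arginf (feasible_inputs f X U (xs (stage_time k)) k)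
             (fun u => c k (xs (stage_time k)) u + F (f (xs (stage_time k)) u k) (next_time k))
             (us k),
         xs ord0 = x0
       & forall k : 'I_T, xs (next_time k) = f (xs (stage_time k)) (us k) k]).
Proof.
split=> [|_ us xs]; first exact: bellman_value_function hFT hF.
exact: (msop_solves_arginf hFT hF hJ us xs hx0).
Qed.
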